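(* Let $n\ge1$, let $\overrightarrow{P_n}$ be the path on $n$ vertices with edges oriented in one direction, with underlying undirected graph $P_n$, and let $X_{\overrightarrow{P_n}}(\mathbf{x},t)=\sum_{\lambda\vdash n}c_\lambda(t)e_\lambda$. Then for every partition $\lambda=(\lambda_1,\dots,\lambda_k)$ of $n$, $$c_\lambda(t)=\sum_{\bar a\in AO_\lambda(P_n)}t^{\mathrm{asc}_{\overrightarrow{P_n}}(\bar a)},$$ where $AO_\lambda(P_n)$ is the set of all acyclic orientations $\bar a$ of $P_n$ such that the numbers of vertices between consecutive sinks of $\bar a$ (including, as one of these numbers, the total number of vertices before the first sink and after the last sink) are $\lambda_1-1,\lambda_2-1,\dots,\lambda_k-1$ in any order, and $\mathrm{asc}_{\overrightarrow{P_n}}(\bar a)$ is the number of edges of $\overrightarrow{P_n}$ for which the orientations of $\overrightarrow{P_n}$ and $\bar a$ agree.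
   Context: $\overrightarrow{P_n}$ is the digraph on $[n]$ with directed edges $1\to2\to\cdots\to n$. For a digraph $\overrightarrow{G}=(V,E)$, a proper coloring is a map $\kappa:V\to\mathbb{P}=\{1,2,3,\dots\}$ with $\kappa(u)\ne\kappa(v)$ whenever $u,v$ are adjacent, $\mathrm{asc}(\kappa)=|\{(u,v)\in E:\kappa(u)<\kappa(v)\}|$ (where $(u,v)$ is directed from $u$ to $v$), and $$X_{\overrightarrow{G}}(\mathbf{x},t)=\sum_{\kappa}t^{\mathrm{asc}(\kappa)}\prod_{v\in V}x_{\kappa(v)},$$ summed over all proper colorings. For $\overrightarrow{P_n}$ this is a polynomial in $t$ with symmetric function coefficients; $e_\lambda=e_{\lambda_1}e_{\lambda_2}\cdots$ are the elementary symmetric functions and $c_\lambda(t)\in\mathbb{Q}[t]$. A sink of an orientation is a vertex with no outgoing edges. If the sinks of $\bar a$ are $s_1<\cdots<s_k$, the $k$ numbers in question are $s_{i+1}-s_i-1$ for $1\le i\le k-1$ together with the single number $(s_1-1)+(n-s_k)$; they are required to equal $\lambda_1-1,\dots,\lambda_k-1$ as a multiset. Example for $n=8$: sinks $2,6,8$ give the numbers $3,1$ and $1+0=1$, corresponding to $\lambda=(4,2,2)$. *)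

(* Defs.v *)
From HB Require Import structures.
From mathcomp Require Import all_boot all_order all_algebra.
From mathcomp Require Import finmap multiset.
From mathcomp Require Import boolp classical_sets fsbigop.

Set Implicit Arguments.
Unset Strict Implicit.
Unset Printing Implicit Defensive.

Import GRing.Theory.

Local Open Scope classical_set_scope.
Local Open Scope mset_scope.
Local Open Scope ring_scope.

(* A formal power series in the commuting variables x_0, x_1, x_2, ... over
   Q[t] is given by its coefficients.  The monomial x_{i1} ... x_{ir} is the
   multiset {i1, ..., ir}, so that the product of monomials is `+`.  The
   variable t is 'X : {poly rat}.  Colours and variables are numbered from 0
   instead of 1.

   \sum_(i \in A) is 0 by convention when infinitely many i in A contribute;
   every set A summed over below is finite. *)
Definition series := {mset nat} -> {poly rat}.

Definition series1 : series := fun m => (m == mset0)%:R.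

Definition series_mul (F G : series) : series := fun m =>
  \sum_(p \in [set p : {mset nat} * {mset nat} | p.1 `+` p.2 = m])
     F p.1 * G p.2.

(* e_k is the sum of the squarefree monomials of degree k. *)
Definition elem (k : nat) : series := fun m =>
  (uniq m && (size m == k))%:R.

Definition elem_part (la : seq nat) : series :=
  foldr series_mul series1 [seq elem k | k <- la].

Definition is_partition (n : nat) (la : seq nat) : bool :=
  [&& sorted geq la, all (leq 1) la & sumn la == n].

(* F = \sum_(la |- n) c_la e_la *)
Definition e_expansion (n : nat) (c : seq nat -> {poly rat}) (F : series) :=
  forall m, F m =
    \sum_(la \in [set la : seq nat | is_partition n la]) c la * elem_part la m.

Section Digraph.
Variables (V : finType) (E : rel V).

Definition adjacent : rel V := fun u v => E u v || E v u.

Definition proper_coloring (ka : {ffun V -> nat}) : bool :=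
  [forall u, forall v, adjacent u v ==> (ka u != ka v)].

Definition asc (ka : {ffun V -> nat}) : nat :=
  #|[pred p : V * V | E p.1 p.2 && (ka p.1 < ka p.2)%N]|.

Definition chromatic : series := fun m =>
  \sum_(ka \in [set ka : {ffun V -> nat} |
                proper_coloring ka /\ seq_mset (codom ka) = m]) ('X^(asc ka) : {poly rat}).

(* An orientation of the underlying undirected graph is its set of arcs,
   where (u, v) is directed from u to v. *)
Definition orientation (a : {set V * V}) : bool :=
  [forall u, forall v,
     if adjacent u v then ((u, v) \in a) (+) ((v, u) \in a)
     else (u, v) \notin a].

Definition arc (a : {set V * V}) : rel V := fun u v => (u, v) \in a.

(* No directed cycle: a directed cycle is an arc (u, v) together with a
   directed path from v back to u. *)
Definition acyclic (a : {set V * V}) : bool :=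
  [forall u, forall v, arc a u v ==> ~~ connect (arc a) v u].

Definition sink (a : {set V * V}) : pred V :=
  fun u => [forall v, ~~ arc a u v].

Definition asc_orientation (a : {set V * V}) : nat :=
  #|[pred p : V * V | E p.1 p.2 && (p \in a)]|.

End Digraph.

(* The vertices 1, ..., n are represented by 0, ..., n - 1 in 'I_n. *)
Definition dipath (n : nat) : rel 'I_n := fun i j => j == i.+1 :> nat.
Arguments dipath : clear implicits.

(* enum lists the elements of 'I_n in increasing order *)
Definition sinks (n : nat) (a : {set 'I_n * 'I_n}) : seq nat :=
  [seq val i | i <- enum (sink a)].

(* For the 0-based positions s_1 < ... < s_k in s, the k numbers
   s_{i+1} - s_i - 1 (i < k), and s_1 + (n - 1 - s_k). *)
Definition gaps (n : nat) (s : seq nat) : seq nat :=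
  if s is s1 :: s' then
    rcons (pairmap (fun x y => y - x - 1)%N s1 s')
          (s1 + (n - 1 - last s1 s'))%N
  else [::].

Definition AO (n : nat) (la : seq nat) : pred {set 'I_n * 'I_n} := fun a =>
  [&& orientation (dipath n) a, acyclic a
    & perm_eq (gaps n (sinks a)) [seq (k - 1)%N | k <- la]].
Arguments AO : clear implicits.

(* Main.v *)
Require Import Defs.
From mathcomp Require Import finmap multiset.
From mathcomp Require Import boolp classical_sets fsbigop.
From mathcomp Require Import mpoly.
From mathcomp Require Import all_boot all_order all_algebra.
From mathcomp Require Import ring zify.

(* Let T be the operator (T f)(a) = x_a * (sum_{b < a} f b + t * sum_{b > a} f b),
   so that X = sum_a (T^(n-1) x)(a): each proper coloring is a word, read letter
   by letter.  The functions
     g_m(a) = sum of t^#{b in S : b > a} * x_S over the m-sets S containing a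
   satisfy g_1 = x, T g_m = g_(m+1) + (t + ... + t^(m-1)) e_m g_1 and
   sum_a g_m(a) = [m]_t e_m, which expands X in the e_la.

   The same recursion governs the orientations.  Write R for an edge that agrees
   with the directed path and L for one that does not.  Between two consecutive
   sinks the edges read L^p R^q with p, q >= 1, which gives t^q e_(p+q); the
   edges R^r before the first sink and L^s after the last one give t^r e_(r+s+1).

   The e_la are linearly independent because, in the lexicographic order, the
   coefficient of prod_i x_0 ... x_(la_i - 1) in e_mu is 0 unless mu <= la, and
   is 1 for mu = la. *)

Set Implicit Arguments.
Unset Strict Implicit.
Unset Printing Implicit Defensive.
Import GRing.Theory.
Local Open Scope mset_scope.
Local Open Scope ring_scope.

(** * Words *)

Lemma sum_tuple_cons (V : nmodType) (A : finType) l (F : l.+1.-tuple A -> V) :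
  \sum_w F w = \sum_a \sum_(w : l.-tuple A) F [tuple of a :: w].
Proof.
rewrite pair_big /= (reindex_onto (fun p : A * l.-tuple A => [tuple of p.1 :: p.2])
  (fun w => (thead w, [tuple of behead w]))) /=; last first.
  by move=> w _; rewrite -tuple_eta.
apply: eq_bigl => -[a w] /=; rewrite theadE; apply/eqP; congr pair; exact: val_inj.
Qed.

Lemma big_tuple0 (V : nmodType) (A : finType) (F : 0.-tuple A -> V) :
  \sum_w F w = F [tuple].
Proof.
by rewrite (bigD1 [tuple]) //= big1 ?addr0 // => w /eqP[]; exact: tuple0.
Qed.

(** A new maximum [M] lies above every element of [S], so it raises each exponent [above S b] by
    exactly one. This makes it the right induction for sums over [above]. *)
Lemma set_ord_max_ind N (P : {set 'I_N} -> Prop) :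
    P set0 ->
    (forall (M : 'I_N) (S : {set 'I_N}), (forall b, b \in S -> b < M)%N ->
       P S -> P (M |: S)) ->
  forall S, P S.
Proof.
move=> P0 PU S; have [k] := ubnP #|S|; elim: k S => // k IHk S leS.
have [->//|[i0 i0S]] := set_0Vmem S.
case: (arg_maxnP (fun i : 'I_N => val i) i0S) => M /= MS maxM; have {}MS : M \in S := MS.
rewrite -(setD1K MS); apply: PU => [b|].
  by rewrite !inE => /andP[bM bS]; rewrite ltn_neqAle bM; exact: maxM.
by apply: IHk; rewrite -ltnS (leq_trans _ leS) // [in X in (_ < X)%N](cardsD1 M) MS.
Qed.

Section Words.
Variables (R : comNzRingType) (t : R).

Definition qint m : R := \sum_(i < m) t ^+ i.

Lemma qintS m : qint m.+1 = 1 + t * qint m.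
Proof.
by rewrite /qint big_ord_recl mulr_sumr; under eq_bigr do rewrite exprS.
Qed.

Variables (N : nat) (x : 'I_N -> R).
Implicit Types (a b : 'I_N) (S : {set 'I_N}).

Definition esym k : R := \sum_(S : {set 'I_N} | #|S| == k) \prod_(i in S) x i.

(** The value 0 on the diagonal kills the words that are not proper colorings; [t] marks an ascent
    from [a] to the next letter [b]. *)
Definition step_weight a b : R := if a == b then 0 else if (a < b)%N then t else 1.

Definition above S a := #|[set b in S | (a < b)%N]|.

Lemma above_set0 a : above set0 a = 0%N.
Proof. by apply/eqP; rewrite cards_eq0; apply/eqP/setP => b; rewrite !inE. Qed.

Lemma above_setU1 (M : 'I_N) S a : (forall b, b \in S -> b < M)%N ->
  above (M |: S) a = ((a < M) + above S a)%N.
Proof.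
move=> ltM; rewrite /above; have [aM|Ma] := ltnP a M.
  have -> : [set b in M |: S | (a < b)%N] = M |: [set b in S | (a < b)%N].
    by apply/setP => b; rewrite !inE; case: eqP => // ->.
  rewrite cardsU1 inE; case: (boolP (M \in S)) => // /ltM; by rewrite ltnn.
congr #|pred_of_set _|; apply/setP => b; rewrite !inE.
by case: eqP => // ->; rewrite ltnNge Ma /= andbF.
Qed.

(** Counted from the largest, the elements of [S] have 0, 1, 2, ... elements above them. *)
Lemma sum_above S : \sum_(b in S) t ^+ above S b = qint #|S|.
Proof.
elim/set_ord_max_ind: S => [|M S ltM IH].
  by rewrite big_set0 cards0 /qint big_ord0.
have MS : M \notin S by apply/negP => /ltM; rewrite ltnn.
rewrite big_setU1 //= cardsU1 MS qintS -IH mulr_sumr; congr +%R.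
  rewrite above_setU1 // ltnn [above S M](_ : _ = 0%N) //.
  apply/eqP; rewrite cards_eq0 -subset0; apply/subsetP => b.
  by rewrite !inE => /andP[/ltM]; lia.
by apply: eq_bigr => b bS; rewrite above_setU1 // ltM // exprS.
Qed.

(** Put j = [above S a] and m = [#|S|]. The elements above [a] give t, ..., t^j. Those below give
    t^j, ..., t^(m-1) if [a] is not in [S], and t^(j+1), ..., t^(m-1) if it is. So t + ... + t^(m-1)
    always occurs, with an extra t^j exactly when [a] is not in [S]. *)
Lemma sum_step_above S a :
  \sum_(b in S) step_weight a b * t ^+ above S b =
  (if a \in S then 0 else t ^+ above S a) + (qint #|S| - 1).
Proof.
elim/set_ord_max_ind: S => [|M S ltM IH].
  by rewrite big_set0 inE above_set0 cards0 /qint big_ord0 /=; ring.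
have MS : M \notin S by apply/negP => /ltM; rewrite ltnn.
have S0 (c : 'I_N) : (M <= c)%N -> above S c = 0%N.
  move=> Mc; apply/eqP; rewrite cards_eq0 -subset0.
  by apply/subsetP => b; rewrite !inE => /andP[/ltM]; lia.
rewrite big_setU1 //= cardsU1 MS qintS.
rewrite (eq_bigr (fun b => t * (step_weight a b * t ^+ above S b))); last first.
  by move=> b bS; rewrite above_setU1 // ltM // exprS; ring.
rewrite -mulr_sumr IH !above_setU1 // ltnn S0 // expr0 /step_weight !inE.
rewrite -(inj_eq val_inj) /=.
have [aM | Ma | /ord_inj->] := ltngtP (a : nat) M.
- by case: ifP => _ /=; rewrite ?add1n ?exprS; ring.
- have /negbTE-> : a \notin S by apply/negP => /ltM; lia.
  by rewrite /= add0n S0 ?(ltnW Ma) // expr0; ring.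
- by rewrite /= (negbTE MS) S0 // expr0; ring.
Qed.

Definition transfer (f : 'I_N -> R) a : R := x a * \sum_b step_weight a b * f b.

(** The function g_m, a refinement of e_m that remembers one marked element. *)
Definition marked_esym m a : R :=
  \sum_(S : {set 'I_N} | (#|S| == m) && (a \in S)) t ^+ above S a * \prod_(i in S) x i.

Lemma marked_esym1 a : marked_esym 1 a = x a.
Proof.
rewrite /marked_esym (big_pred1 [set a]) => [|S]; last first.
  apply/idP/eqP => [/andP[/cards1P[b ->]]|->]; last by rewrite cards1 set11.
  by rewrite inE => /eqP->.
rewrite big_set1 [above _ _](_ : _ = 0%N) ?mul1r //.
apply/eqP; rewrite cards_eq0 -subset0; apply/subsetP => b.
by rewrite !inE => /andP[/eqP->]; lia.
Qed.

Lemma sum_marked_esym m : \sum_a marked_esym m a = qint m * esym m.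
Proof.
rewrite /marked_esym /esym mulr_sumr.
rewrite (exchange_big_dep (fun S : {set 'I_N} => #|S| == m)) /=; last first.
  by move=> a S _ /andP[].
apply: eq_bigr => S /eqP Sm; rewrite -big_distrl -Sm -sum_above /=; congr (_ * _).
by apply: eq_bigl => a; rewrite eqxx.
Qed.

(** In [sum_step_above] the summand [m]_t - 1 is the same for all [S] and collects to e_m. The extra
    power of t belongs to the m-sets [S] without [a]; these correspond to the (m+1)-sets containing
    [a], and adding [a] leaves the elements above [a] unchanged. *)
Lemma transfer_marked_esym m a :
  transfer (marked_esym m) a = marked_esym m.+1 a + (qint m - 1) * esym m * x a.
Proof.
rewrite /transfer.
have -> : \sum_b step_weight a b * marked_esym m b =
    \sum_(S : {set 'I_N} | #|S| == m)
      ((if a \in S then 0 else t ^+ above S a) + (qint m - 1)) * \prod_(i in S) x i.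
  under eq_bigr do rewrite /marked_esym mulr_sumr.
  rewrite (exchange_big_dep (fun S : {set 'I_N} => #|S| == m)) /=; last first.
    by move=> b S _ /andP[].
  apply: eq_bigr => S /eqP Sm; rewrite -Sm -sum_step_above mulr_suml.
  rewrite eqxx /=; by apply: eq_bigr => b bS; ring.
under eq_bigr do rewrite mulrDl.
rewrite big_split /= -mulr_sumr mulrDr; congr +%R; last by rewrite /esym; ring.
rewrite /marked_esym mulr_sumr.
rewrite (bigID (fun S => a \in S)) /= [X in X + _]big1 ?add0r; last first.
  by move=> S /andP[_ ->]; ring.
rewrite [RHS](reindex_onto (fun S => a |: S) (fun S => S :\ a)) /=; last first.
  by move=> S /andP[_ aS]; rewrite setD1K.
apply: eq_big => S.
  rewrite cardsU1 setU11 andbT; have [aS|aS] := boolP (a \in S); last first.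
    by rewrite setU1K // eqxx !andbT.
  rewrite andbF; symmetry; apply/negbTE/nandP; right.
  by apply: contraTneq aS => <-; rewrite setD11.
move=> /andP[_ aS]; rewrite (negbTE aS) big_setU1 //= mulrCA; congr (_ ^+ _ * _).
by apply: eq_card => b; rewrite !inE; case: eqP => // ->; rewrite ltnn andbF.
Qed.

(* block_rec e phi l m is obtained from T^l g_m by expanding with
   T g_m = g_(m+1) + ([m]_t - 1) e_m g_1 and then replacing each g_k by phi k. *)
Fixpoint block_rec (e : nat -> R) (phi : nat -> R) l m : R :=
  if l is l'.+1 then
    block_rec e phi l' m.+1 + (qint m - 1) * e m * block_rec e phi l' 1
  else phi m.

Lemma sum_iter_transferD l f h c :
  \sum_a iter l transfer (fun a => f a + c * h a) a =
  \sum_a iter l transfer f a + c * \sum_a iter l transfer h a.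
Proof.
rewrite mulr_sumr -big_split /=; apply: eq_bigr => a _.
elim: l a => //= l IHl a; rewrite /transfer [c * _]mulrCA -mulrDr; congr (_ * _).
rewrite mulr_sumr -big_split /=; apply: eq_bigr => b _.
by rewrite IHl mulrDr mulrCA.
Qed.

Lemma sum_iter_transfer l m :
  \sum_a iter l transfer (marked_esym m) a =
  block_rec esym (fun k => qint k * esym k) l m.
Proof.
elim: l m => [|l IHl] m /=; first exact: sum_marked_esym.
under eq_bigr do rewrite -iterS iterSr.
have -> : transfer (marked_esym m) =
  fun a => marked_esym m.+1 a + (qint m - 1) * esym m * marked_esym 1 a.
  by apply/funext => a; rewrite transfer_marked_esym marked_esym1.
by rewrite sum_iter_transferD !IHl.
Qed.

Fixpoint word_weight a (w : seq 'I_N) : R :=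
  if w is b :: w' then x a * (step_weight a b * word_weight b w') else x a.

Lemma sum_word_weight l :
  \sum_a \sum_(w : l.-tuple 'I_N) word_weight a w =
  block_rec esym (fun k => qint k * esym k) l 1.
Proof.
rewrite -sum_iter_transfer; apply: eq_bigr => a _.
have -> : marked_esym 1 = x by apply/funext => b; exact: marked_esym1.
elim: l a => [|l IHl] a; first by rewrite big_tuple0.
rewrite sum_tuple_cons /= /transfer mulr_sumr; apply: eq_bigr => b _.
by rewrite -IHl !mulr_sumr.
Qed.

End Words.

(** * Orientations as bit sequences *)

(* A bit is true for an edge that agrees with the directed path.  The gaps plus
   one of an orientation are computed by reading its edges d from left to right:
   r is the position of the first sink, j the number of edges read since the last
   sink and b the last of these edges. *)
Fixpoint block_sizes (b : bool) (j r : nat) (d : seq bool) : seq nat :=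
  match d with
  | [::] => if b then [:: j; r.+1] else [:: (r + j).+1]
  | c :: d' => if b && ~~ c then j :: block_sizes false 1 r d'
               else block_sizes c j.+1 r d'
  end.

(** No sink has been passed yet: the [r] edges read so far all agree with the path. The first
    [false], or the end of the path, makes vertex [r] the first sink. *)
Fixpoint sizes_from (r : nat) (d : seq bool) : seq nat :=
  match d with
  | [::] => [:: r.+1]
  | c :: d' => if c then sizes_from r.+1 d' else block_sizes false 1 r d'
  end.

Section Orientations.
Variables (R : comNzRingType) (t : R) (e : nat -> R).

Definition orientation_sum l (sz : seq bool -> seq nat) : R :=
  \sum_(d : l.-tuple bool) t ^+ count id d * \prod_(k <- sz d) e k.

Lemma orientation_sum0 sz : orientation_sum 0 sz = \prod_(k <- sz [::]) e k.
Proof. by rewrite /orientation_sum big_tuple0 /= expr0 mul1r. Qed.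

Lemma orientation_sumS l sz :
  orientation_sum l.+1 sz =
  t * orientation_sum l (fun d => sz (true :: d)) +
  orientation_sum l (fun d => sz (false :: d)).
Proof.
rewrite /orientation_sum sum_tuple_cons big_bool /=; congr (_ + _).
rewrite mulr_sumr; apply: eq_bigr => d _.
by rewrite add1n exprS mulrA.
Qed.

Lemma orientation_sum_cons l k sz :
  orientation_sum l (fun d => k :: sz d) = e k * orientation_sum l sz.
Proof.
rewrite /orientation_sum mulr_sumr; apply: eq_bigr => d _.
by rewrite big_cons mulrCA.
Qed.

(** The last run, of [m] vertices counting its sink, is joined with the [r] vertices before the
    first sink. *)
Let tail_phi r m := e (r + m).

(* The factor [j]_t - 1 sums over the ways L^p R^q, with p + q = j and q >= 1, of
   having reached an edge R, while block_sizes false stands for L^j. *)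
Lemma block_rec_orientation r l j :
  block_rec t e (tail_phi r) l.+1 j =
  orientation_sum l (block_sizes false j r) +
  (qint t j - 1) * orientation_sum l (block_sizes true j r).
Proof.
elim: l j => [|l IHl] j.
  rewrite !orientation_sum0 /= /tail_phi !big_cons !big_nil addnS addn1; ring.
rewrite -[LHS]/(block_rec t e (tail_phi r) l.+1 j.+1 +
  (qint t j - 1) * e j * block_rec t e (tail_phi r) l.+1 1) !IHl !orientation_sumS /=.
rewrite orientation_sum_cons !qintS /qint big_ord0; ring.
Qed.

(** The index [i] is the number of edges R read before the first L or the end of the path; the first
    sink is then at [r + i]. *)
Lemma orientation_sum_sizes l r :
  orientation_sum l (sizes_from r) =
  \sum_(i < l.+1) t ^+ i * block_rec t e (tail_phi (r + i)) (l - i) 1.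
Proof.
elim: l r => [|l IHl] r.
  by rewrite orientation_sum0 big_ord1 /= big_seq1 /tail_phi expr0 mul1r addn0 addn1.
rewrite orientation_sumS /= IHl [RHS]big_ord_recl addrC; congr (_ + _).
  rewrite subn0 addn0 block_rec_orientation [qint _ 1]qintS /qint big_ord0; ring.
rewrite mulr_sumr; apply: eq_bigr => i _; rewrite lift0 exprS mulrA subSS.
by rewrite addnS addSn.
Qed.

(** Either the current block grows to the very end, or it is closed after [i] further steps and a
    new block of size 1 starts. *)
Lemma block_rec_unroll phi l m :
  block_rec t e phi l m = phi (m + l)%N +
  \sum_(i < l) (qint t (m + i) - 1) * e (m + i)%N * block_rec t e phi (l.-1 - i) 1.
Proof.
elim: l m => [|l IHl] m /=; first by rewrite big_ord0 addr0 addn0.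
rewrite IHl big_ord_recl addn0 subn0 addSnnS -addrA; congr +%R.
rewrite addrC; congr +%R; apply: eq_bigr => i _; rewrite lift0 addSnnS.
by congr (_ * block_rec _ _ _ _ _); lia.
Qed.

(** Both sides are expanded at the first closed block. Without one, the left side is [l+1]_t
    e_(l+1), and the right side spreads it as t^i e_(l+1) over the positions [i] of the only sink.
    With one, what follows on the left is a shorter instance, and the induction hypothesis brings in
    the same initial run as on the right. *)
Lemma block_rec_qint l :
  block_rec t e (fun k => qint t k * e k) l 1 = orientation_sum l (sizes_from 0).
Proof.
rewrite orientation_sum_sizes; elim/ltn_ind: l => l IHl.
rewrite block_rec_unroll.
under [RHS]eq_bigr do rewrite block_rec_unroll mulrDr.
rewrite big_split /= {1}/qint mulr_suml add1n; congr +%R.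
  apply: eq_bigr => i _; rewrite /tail_phi; congr (_ * e _).
  by case: i => i /= ?; lia.
(* For [i = l] no edge is left after the initial run, so no block can be closed. *)
rewrite [RHS]big_ord_recr /= subnn big_ord0 mulr0 addr0.
(* The term with [r] initial edges R and a first closed block of size [i.+1]. The left side sums it
   over [i] first, the right side over [r] first, both on the triangle [i + r < l]. *)
pose F i r := t ^+ r * ((qint t i.+1 - 1) * e i.+1 *
  block_rec t e (tail_phi r) (l.-1 - r - i) 1).
transitivity (\sum_(i < l) \sum_(r < l | (i + r < l)%N) F i r).
  apply: eq_bigr => i _; rewrite !add1n IHl; last by case: i => i /=; lia.
  rewrite mulr_sumr (big_ord_widen_cond l xpredT (fun r => (qint t i.+1 - 1) * e i.+1 *
    (t ^+ r * block_rec t e (tail_phi r) (l.-1 - i - r) 1))); last by case: i => i /=; lia.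
  apply: eq_big => r; first by case: r i => r ? [i ?] /=; lia.
  by move=> _; rewrite /F subnAC; ring.
rewrite (exchange_big_dep xpredT) //=; apply: eq_bigr => r _.
rewrite mulr_sumr (big_ord_widen_cond l xpredT (fun i =>
  t ^+ r * ((qint t (1 + i) - 1) * e (1 + i)%N *
  block_rec t e (tail_phi (0 + r)) ((l - r).-1 - i) 1))); last by lia.
apply: eq_big => i; first by case: r i => r ? [i ?] /=; lia.
by move=> _; rewrite /F !add1n add0n; congr (_ * (_ * block_rec _ _ _ _ _)); lia.
Qed.

End Orientations.

Lemma card_dipath l (Q : rel 'I_l.+1) :
  #|[pred p : 'I_l.+1 * 'I_l.+1 | dipath l.+1 p.1 p.2 && Q p.1 p.2]| =
  (\sum_(i < l) Q (widen_ord (leqnSn l) i) (lift ord0 i))%N.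
Proof.
pose f (i : 'I_l) := (widen_ord (leqnSn l) i, lift ord0 i).
have f_inj : injective f by move=> i j [ij]; exact: val_inj.
rewrite (eq_card (B := f @: [set i | Q (f i).1 (f i).2])) => [|[u v]].
  rewrite card_imset // -sum1_card big_mkcond /=.
  by apply: eq_bigr => i _; rewrite inE; case: (Q _ _).
rewrite !inE /dipath /=; apply/andP/imsetP => [[/eqP vu Quv]|[i + [-> ->]]].
  have ul : (u < l)%N by rewrite -ltnS -vu.
  have fE : f (Ordinal ul) = (u, v).
    by congr pair; apply: val_inj => //=; rewrite vu /bump add1n.
  have Qf : Q (f (Ordinal ul)).1 (f (Ordinal ul)).2 by rewrite fE.
  by exists (Ordinal ul); rewrite ?inE.
by rewrite inE /= /bump add1n.
Qed.

Definition arcs_of_bits n (d : seq bool) : {set 'I_n * 'I_n} :=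
  [set p : 'I_n * 'I_n | (p.2 == p.1.+1 :> nat) && nth false d p.1
        || (p.1 == p.2.+1 :> nat) && ~~ nth false d p.2].

Lemma orientation_arcs_of_bits n d : orientation (dipath n) (arcs_of_bits n d).
Proof.
apply/forallP => u; apply/forallP => v; rewrite /adjacent /dipath !inE /=.
have [vu|vu] := eqVneq (v : nat) u.+1; have [uv|uv] := eqVneq (u : nat) v.+1 => //=.
- lia.
- by rewrite orbF; case: nth.
- by case: nth.
Qed.

(** The edge between [u] and [v] is the only one joining the two sides of the path, and it points to
    the side of [v]; a walk from [v] therefore never leaves that side. *)
Lemma acyclic_arcs_of_bits n d : acyclic (arcs_of_bits n d).
Proof.
apply/forallP => u; apply/forallP => v; apply/implyP => uv.
have stay (P : pred 'I_n) : {in P, forall x y, Defs.arc (arcs_of_bits n d) x y -> P y} ->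
    P v -> ~~ P u -> ~~ connect (Defs.arc (arcs_of_bits n d)) v u.
  move=> Pstep Pv; apply: contra => /connectP[p pth ->].
  elim: p v pth Pv {uv} => //= y p IHp x /andP[xy yp] Px.
  exact: IHp yp (Pstep x Px y xy).
move: uv; rewrite /Defs.arc inE /= => /orP[/andP[/eqP vu du]|/andP[/eqP uv dv]].
- apply (stay [pred w : 'I_n | u < w]%N) => /=; [|lia|lia].
  move=> x; rewrite !inE /= => ux y; rewrite /Defs.arc inE /=.
  case/orP=> [/andP[/eqP]|/andP[/eqP xy dy]]; first lia.
  rewrite ltn_neqAle -ltnS -xy ux andbT; by apply: contraNneq dy => <-.
- apply (stay [pred w : 'I_n | w < u]%N) => /=; [|lia|lia].
  move=> x; rewrite !inE /= => ux y; rewrite /Defs.arc inE /=.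
  case/orP=> [/andP[/eqP yx dx]|/andP[/eqP]]; last lia.
  rewrite yx ltn_neqAle ux andbT; apply: contraNneq dv; rewrite uv => -[<-]; exact: dx.
Qed.

Lemma sum_orientation (V : nmodType) l (F : {set 'I_l.+1 * 'I_l.+1} -> V) :
  \sum_(a | orientation (dipath l.+1) a) F a =
  \sum_(d : l.-tuple bool) F (arcs_of_bits l.+1 d).
Proof.
pose bits (a : {set 'I_l.+1 * 'I_l.+1}) :=
  [tuple (widen_ord (leqnSn l) i, lift ord0 i) \in a | i < l].
rewrite (reindex_onto (fun d : l.-tuple bool => arcs_of_bits l.+1 d) bits) /=.
  apply: eq_bigl => d; rewrite orientation_arcs_of_bits /=; apply/eqP/eq_from_tnth => i.
  rewrite tnth_mktuple !inE /= /bump /= add1n eqxx (tnth_nth false) /=.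
  by rewrite [_ == _.+2](_ : _ = false) ?orbF //; lia.
move=> a /forallP oa; apply/setP => -[u v].
have bitsE (i j : 'I_l.+1) : (j = i.+1 :> nat) -> nth false (bits a) i = ((i, j) \in a).
  move=> ji; have il : (i < l)%N by rewrite -ltnS -ji.
  rewrite -[val i]/(val (Ordinal il)) -tnth_nth tnth_mktuple.
  by congr ((_, _) \in a); apply: val_inj => //=.
rewrite inE /=; have /forallP/(_ v) := oa u; rewrite /adjacent /dipath.
have [vu _|vu] := eqVneq (v : nat) u.+1.
  by rewrite (bitsE u v vu) [_ == _.+1 :> nat](_ : _ = false) ?orbF //; lia.
have [uv /=|uv /= /negbTE->//] := eqVneq (u : nat) v.+1.
by rewrite (bitsE v u uv); do 2!case: (_ \in a).
Qed.

Lemma asc_arcs_of_bits l (d : l.-tuple bool) :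
  asc_orientation (dipath l.+1) (arcs_of_bits l.+1 d) = count id d.
Proof.
transitivity (\sum_(i < l) tnth d i)%N; last first.
  rewrite -sum1_count [RHS]big_mkcond [RHS]big_tuple.
  by apply: eq_bigr => i _; case: (tnth d i).
transitivity #|[pred p : 'I_l.+1 * 'I_l.+1 |
  dipath l.+1 p.1 p.2 && ((p.1, p.2) \in arcs_of_bits l.+1 d)]|.
  by apply: eq_card => -[u v].
rewrite (card_dipath (fun u v => (u, v) \in arcs_of_bits l.+1 d)).
apply: eq_bigr => i _; rewrite inE /= /bump add1n eqxx (tnth_nth false) /=.
by rewrite [_ == _.+2](_ : _ = false) ?orbF //; lia.
Qed.

(** A sink has an edge R before it and an edge L after it. The [true] put in front of [d] and the
    default [false] past its end bring the two end vertices under the same rule. *)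
Lemma sink_arcs_of_bits l (d : l.-tuple bool) u :
  sink (arcs_of_bits l.+1 d) u = nth true (true :: d) u && ~~ nth false d u.
Proof.
apply/forallP/andP => [su|[du Ndu] v]; last first.
  rewrite /Defs.arc inE /= negb_or !negb_and Ndu orbT /= negbK.
  have [uv|//] := eqVneq (u : nat) v.+1; move: du; rewrite uv /=.
  by rewrite (set_nth_default false) // size_tuple; have := ltn_ord u; lia.
split.
  case E: (val u) => [|k] //=.
  have kl : (k < l)%N by rewrite -ltnS -E ltn_ord.
  have /= := su (widen_ord (leqnSn l) (Ordinal kl)).
  rewrite /Defs.arc inE /= E eqxx negb_or => /andP[_]; rewrite /= negbK.
  by rewrite (set_nth_default true) ?size_tuple.
have [ul|lu] := ltnP u l; last by rewrite nth_default ?size_tuple.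
have := su (lift ord0 (Ordinal ul)).
by rewrite /Defs.arc inE /= /bump add1n eqxx /= negb_or => /andP[].
Qed.

(** Here [i] is the current vertex and [b] the bit of the edge before it. *)
Fixpoint sink_positions i b (d : seq bool) : seq nat :=
  match d with
  | [::] => if b then [:: i] else [::]
  | c :: d' => if b && ~~ c then i :: sink_positions i.+1 c d'
               else sink_positions i.+1 c d'
  end.

Lemma sink_positionsE i b d :
  sink_positions i b d =
  [seq u <- iota i (size d).+1 | nth true (b :: d) (u - i) && ~~ nth false d (u - i)].
Proof.
elim: d i b => [|c d IHd] i b; first by rewrite /= subnn /= andbT; case: b.
have -> : iota i (size (c :: d)).+1 = i :: iota i.+1 (size d).+1 by [].
rewrite [RHS]/= subnn /= IHd.
rewrite (@eq_in_filter _ _ (fun u =>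
  nth true (b :: c :: d) (u - i) && ~~ nth false (c :: d) (u - i))) //.
by move=> u; rewrite mem_iota => /andP[iu _]; rewrite -(subnSK iu).
Qed.

Lemma sinks_arcs_of_bits l (d : l.-tuple bool) :
  sinks (arcs_of_bits l.+1 d) = sink_positions 0 true d.
Proof.
rewrite sink_positionsE size_tuple -[iota _ _]val_enum_ord /sinks filter_map; congr map.
rewrite {1}/enum_mem -enumT; apply: eq_filter => u.
by rewrite [LHS]sink_arcs_of_bits /= subn0.
Qed.

(** The vertex [x] is the last sink passed and [i] the current vertex, so [i - x] is the number of
    edges read since that sink. *)
Lemma block_sizesE i x b d r : (x < i)%N ->
  block_sizes b (i - x) r d =
  map S (rcons (pairmap (fun y z => z - y - 1)%N x (sink_positions i b d))
               (r + (i + size d - last x (sink_positions i b d))))%N.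
Proof.
elim: d i x b => [|c d IHd] i x b xi /=.
  case: b => /=; last by rewrite addn0.
  by rewrite addn0 subnn addn0; congr [:: _; _]; lia.
rewrite addnS -addSn; case: ifP => [/andP[_ /negbTE->]|_] /=; last first.
  by rewrite -subSn ?IHd 1?ltnW.
by rewrite -{1}[1%N](subSnn i) IHd //; congr (_ :: _); lia.
Qed.

Lemma sizes_fromE i d :
  sizes_from i d = map S (gaps (i + size d).+1 (sink_positions i true d)).
Proof.
elim: d i => [|c d IHd] i /=; first by rewrite addn0 subn1 subnn addn0.
case: c => /=; first by rewrite IHd addSnnS.
by rewrite -{1}[1%N](subSnn i) block_sizesE // /gaps /= addSnnS subn1.
Qed.

Lemma sumn_block_sizes b j r d : sumn (block_sizes b j r d) = (j + r + size d).+1.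
Proof.
elim: d b j => [|c d IHd] [] j /=; rewrite ?IHd; try lia.
by case: c => /=; rewrite IHd; lia.
Qed.

Lemma sumn_sizes_from r d : sumn (sizes_from r d) = (r + size d).+1.
Proof.
elim: d r => [|c d IHd] r /=; first lia.
by case: c; rewrite ?IHd ?sumn_block_sizes; lia.
Qed.

Lemma AO_arcs_of_bits l (d : l.-tuple bool) la : is_partition l.+1 la ->
  AO l.+1 la (arcs_of_bits l.+1 d) = (la == sort geq (sizes_from 0 d)).
Proof.
case/and3P=> la_sorted la_pos la_sum.
rewrite /AO orientation_arcs_of_bits acyclic_arcs_of_bits sinks_arcs_of_bits /=.
have geq_tr : transitive geq by move=> x y z yx xz; exact: leq_trans xz yx.
have geq_anti : antisymmetric geq by move=> x y; rewrite andbC => /anti_leq.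
have geq_total : total geq by move=> x y; exact: leq_total.
have -> : perm_eq (gaps l.+1 (sink_positions 0 true d)) [seq (k - 1)%N | k <- la] =
          perm_eq (sizes_from 0 d) la.
  rewrite sizes_fromE size_tuple; set s := gaps _ _.
  (* The parts are positive, so the truncated subtraction of 1 can be undone. *)
  have {2}-> : la = map S [seq (k - 1)%N | k <- la].
    rewrite -map_comp map_id_in // => k /(allP la_pos) k0 /=; rewrite subn1 prednK //.
  apply/idP/idP => [|/(perm_map predn)]; first exact: perm_map.
  by rewrite !(mapK succnK).
apply/idP/eqP => [sla|->]; last by rewrite perm_sym perm_sort.
apply: (sorted_eq geq_tr geq_anti) => //; first exact: sort_sorted.
by rewrite perm_sym perm_sort.
Qed.

Lemma is_partition_sizes l (d : l.-tuple bool) :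
  is_partition l.+1 (sort geq (sizes_from 0 d)).
Proof.
have geq_total : total geq by move=> x y; exact: leq_total.
rewrite /is_partition sort_sorted //=; apply/andP; split.
  by rewrite all_sort sizes_fromE; apply/allP => _ /mapP[k _ ->].
have /perm_sumn-> : perm_eq (sort geq (sizes_from 0 d)) (sizes_from 0 d).
  by rewrite perm_sort.
by rewrite sumn_sizes_from size_tuple.
Qed.

(** * Coefficients of series in finitely many variables *)

Lemma fsbig_finType (V : nmodType) (I : finType) (J : choiceType) (P : pred I)
    (A : set J) (h : I -> J) (F : J -> V) :
    {in P &, injective h} -> (forall j, A j <-> exists2 i, P i & j = h i) ->
  \sum_(j \in A) F j = \sum_(i | P i) F (h i).
Proof.
move=> h_inj hA; transitivity (\sum_(i <- enum P) F (h i)); last by rewrite big_enum.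
rewrite -(big_map h xpredT F) [RHS]fsbig_seq; last first.
  rewrite map_inj_in_uniq ?enum_uniq // => i j.
  by rewrite !mem_enum; exact: h_inj.
apply: eq_fsbigl; apply/seteqP; split => j /=; rewrite hA.
  by move=> [i Pi ->]; apply: map_f; rewrite mem_enum.
by move=> /mapP[i]; rewrite mem_enum => Pi ->; exists i.
Qed.

Section Truncation.
Variable N : nat.
Implicit Types (m p q : {mset nat}).

Definition colors_below m := forall x, (N <= x)%N -> m x = 0%N.

Definition exponents m : 'X_{1..N} := [multinom m (val i) | i < N].

Definition mset_of_exponents (u : 'X_{1..N}) : {mset nat} :=
  [fsfun x in [fset y in iota 0 N]%fset => oapp u 0%N (insub x)].

Lemma mset_of_exponentsE u x : mset_of_exponents u x = oapp u 0%N (insub x).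
Proof.
rewrite fsfunE; case: ifP => //; rewrite in_fset /= mem_iota add0n /=.
by case: insubP => [i ->|].
Qed.

Lemma exponentsK m : colors_below m -> mset_of_exponents (exponents m) = m.
Proof.
move=> mN; apply/msetP => x; rewrite mset_of_exponentsE.
case: insubP => [i _ <-|]; first by rewrite /= mnmE.
by rewrite -leqNgt => /mN->.
Qed.

Lemma mset_of_exponentsK u : exponents (mset_of_exponents u) = u.
Proof. by apply/mnmP => i; rewrite mnmE mset_of_exponentsE valK. Qed.

Lemma colors_below_exponents u : colors_below (mset_of_exponents u).
Proof.
move=> x Nx; rewrite mset_of_exponentsE insubF //; lia.
Qed.

Lemma exponents_inj m p : colors_below m -> colors_below p ->
  exponents m = exponents p -> m = p.
Proof. by move=> mN pN mp; rewrite -(exponentsK mN) mp exponentsK. Qed.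

Lemma exponentsD m p : exponents (m `+` p)%mset = (exponents m + exponents p)%MM.
Proof. by apply/mnmP => i; rewrite mnmDE !mnmE msetE2. Qed.

Lemma colors_belowD m p :
  colors_below (m `+` p)%mset <-> colors_below m /\ colors_below p.
Proof.
split=> [mpN|[mN pN] x Nx]; last by rewrite msetE2 mN ?pN.
by split=> x /mpN; rewrite msetE2; lia.
Qed.

(** Only monomials in the first [N] variables are compared. Products respect this, since every
    factor of such a monomial is again one, and each single coefficient is reached by taking [N]
    large. *)
Definition represents (F : series) (f : {mpoly {poly rat}[N]}) :=
  forall m, colors_below m -> F m = f@_(exponents m).

Lemma represents1 : represents series1 1.
Proof.
move=> m mN; rewrite mcoeff1 /series1; congr (nat_of_bool _)%:R.
apply/eqP/eqP => [->|m0]; first by apply/mnmP => i; rewrite mnmE mset0E mnm0E.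
rewrite -(exponentsK mN) m0; apply/msetP => x; rewrite mset_of_exponentsE mset0E.
by case: insub => //= i; rewrite mnm0E.
Qed.

Lemma represents_mul F G f g :
  represents F f -> represents G g -> represents (series_mul F G) (f * g).
Proof.
move=> Ff Gg m mN; rewrite mcoeffM /series_mul.
set d := (mdeg _).+1.
rewrite (fsbig_finType (P := fun u : 'X_{1..N < d, d} => exponents m == (u.1 + u.2)%MM)
  (h := fun u => (mset_of_exponents u.1, mset_of_exponents u.2))) => [|u v _ _|[p q]].
- apply: eq_bigr => u _.
  by rewrite Ff ?Gg ?mset_of_exponentsK //; exact: colors_below_exponents.
- move=> [/(congr1 exponents) + /(congr1 exponents)]; rewrite !mset_of_exponentsK.
  by case: u v => [u1 u2] [v1 v2] /= uv1 uv2; congr pair; exact: val_inj.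
split=> [/= pqm|[u /eqP mu [-> ->]] /=]; last first.
  apply: exponents_inj => //.
    by apply/colors_belowD; split; exact: colors_below_exponents.
  by rewrite exponentsD !mset_of_exponentsK.
have [pN qN] : colors_below p /\ colors_below q by apply/colors_belowD; rewrite pqm.
have pd : (mdeg (exponents p) < d)%N by rewrite ltnS -pqm exponentsD mdegD leq_addr.
have qd : (mdeg (exponents q) < d)%N by rewrite ltnS -pqm exponentsD mdegD leq_addl.
exists (BMultinom pd, BMultinom qd) => /=; first by rewrite -pqm exponentsD.
by rewrite !exponentsK.
Qed.

Lemma mdeg_exponents m : colors_below m -> mdeg (exponents m) = size m.
Proof.
move=> mN; rewrite mdegE; under eq_bigr do rewrite mnmE -count_mem_mset.
have {mN}: all (fun x => x < N)%N m.
  by apply/allP => x; rewrite in_mset; have [//|/mN->] := ltnP x N.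
elim: (m : seq nat) => [|x s IHs] /=; first by rewrite big1.
move=> /andP[xN /IHs <-]; rewrite big_split /= -[RHS]add1n; congr (_ + _)%N.
rewrite (bigD1 (Ordinal xN)) //= eqxx big1 // => i.
by rewrite -val_eqE /= eq_sym => /negbTE->.
Qed.

Lemma represents_elem k : represents (elem k) (esym (fun i => 'X_i) k).
Proof.
(* At the indeterminates, [esym] is convertible to [mesym]. *)
move=> m mN; rewrite -[esym _ _]/(mesym N _ k) mcoeff_mesym /elem /mechar.
rewrite mdeg_exponents // andbC; congr (nat_of_bool (_ && _))%:R.
apply/idP/forallP => [m_uniq i|m_le1].
  by rewrite mnmE -count_mem_mset count_uniq_mem // leq_b1.
apply: count_mem_uniq => x; rewrite count_mem_mset.
have : (m x <= 1)%N.
  by have [/mN->//|xN] := leqP N x; have := m_le1 (Ordinal xN); rewrite mnmE.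
by rewrite in_mset; case: (m x) => [|[]].
Qed.

Lemma represents_elem_part la :
  represents (elem_part la) (\prod_(k <- la) esym (fun i => 'X_i) k).
Proof.
elim: la => [|k la IHla]; first by rewrite big_nil; exact: represents1.
rewrite big_cons; apply: represents_mul IHla; exact: represents_elem.
Qed.

End Truncation.

(** * Proper colorings of the directed path as words *)

Lemma word_weightE (R : comNzRingType) (t : R) N (x : 'I_N -> R) a w :
  word_weight t x a w = \prod_(b <- a :: w) x b *
    \prod_(i < size w) step_weight t (nth a (a :: w) i) (nth a w i).
Proof.
elim: w a => [|b w IHw] a; first by rewrite big_seq1 big_ord0 mulr1.
rewrite /= IHw [in RHS]big_cons [\prod_(i < _.+1) _]big_ord_recl /=.
rewrite [RHS]mulrACA -mulrA; congr (_ * (_ * (_ * _))).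
apply: eq_bigr => i _; rewrite /= !(set_nth_default b a) //=; have := ltn_ord i; lia.
Qed.

Section Chromatic.
Variables (l N : nat).
Implicit Type w : l.+1.-tuple 'I_N.

Definition coloring_of_word w : {ffun 'I_l.+1 -> nat} := [ffun i => val (tnth w i)].

Lemma codom_coloring w : codom (coloring_of_word w) = map val w.
Proof.
rewrite codomE -[in RHS](map_tnth_enum w) -[RHS]map_comp.
by apply: eq_map => i; rewrite ffunE.
Qed.

Lemma proper_coloring_dipath (ka : {ffun 'I_l.+1 -> nat}) :
  proper_coloring (dipath l.+1) ka =
  [forall i : 'I_l, ka (widen_ord (leqnSn l) i) != ka (lift ord0 i)].
Proof.
apply/forallP/forallP => [ka_ok i|ka_ok u].
  have /forallP/(_ (lift ord0 i))/implyP := ka_ok (widen_ord (leqnSn l) i).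
  by apply; rewrite /adjacent /dipath /= /bump add1n eqxx.
have ok (v w : 'I_l.+1) : (w = v.+1 :> nat) -> ka v != ka w.
  move=> wv; have vl : (v < l)%N by rewrite -ltnS -wv.
  have := ka_ok (Ordinal vl); congr (_ != _); congr (ka _); exact: val_inj.
apply/forallP => v; apply/implyP => /orP[] /eqP; first exact: ok.
by move/ok; rewrite eq_sym.
Qed.

Lemma prod_step_weight w (R : comNzRingType) (t : R) :
  \prod_(i < l) step_weight t (tnth w (widen_ord (leqnSn l) i)) (tnth w (lift ord0 i)) =
  if proper_coloring (dipath l.+1) (coloring_of_word w)
  then t ^+ asc (dipath l.+1) (coloring_of_word w) else 0.
Proof.
rewrite proper_coloring_dipath; case: ifPn => [/forallP w_ok|].
  rewrite [asc _ _](card_dipath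
    (fun u v => coloring_of_word w u < coloring_of_word w v)%N).
  rewrite expr_sum; apply: eq_bigr => i _; rewrite /step_weight !ffunE.
  have := w_ok i; rewrite !ffunE val_eqE => /negbTE->.
  by case: ifP.
rewrite negb_forall => /existsP[i]; rewrite negbK !ffunE val_eqE => wi.
by rewrite (bigD1 i) //= /step_weight wi mul0r.
Qed.

Lemma represents_chromatic :
  represents (chromatic (dipath l.+1))
    (\sum_(a : 'I_N) \sum_(w : l.-tuple 'I_N) word_weight ('X)%:MP (fun i => 'X_i) a w).
Proof.
move=> m mN; rewrite -(sum_tuple_cons
  (fun w : l.+1.-tuple 'I_N => word_weight _ _ (thead w) (behead w))) /=.
rewrite /chromatic raddf_sum /=.
rewrite (fsbig_finType (h := coloring_of_word)
  (P := fun w => proper_coloring (dipath l.+1) (coloring_of_word w) &&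
                 (seq_mset (map val w) == m))); first 1 last.
- move=> v w _ _ vw; apply: eq_from_tnth => i; apply: val_inj.
  by have := congr1 (fun f : {ffun _} => f i) vw; rewrite !ffunE.
- move=> ka /=; split=> [[ka_ok kam]|[w /andP[w_ok /eqP wm] ->]]; last first.
    by rewrite codom_coloring.
  (* Each color of [ka] occurs in [m], hence is below [N], so [ka] is a word over ['I_N]. *)
  have kaN i : (ka i < N)%N.
    rewrite ltnNge; apply/negP => /mN; rewrite -kam mset_seqE.
    by apply/eqP; rewrite -lt0n -has_count has_pred1 codom_f.
  pose w := [tuple Ordinal (kaN i) | i < l.+1].
  have kaw : ka = coloring_of_word w.
    by apply/ffunP => i; rewrite ffunE tnth_mktuple.
  by exists w => //; rewrite -codom_coloring -kaw ka_ok kam eqxx.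
rewrite big_mkcond /=; apply: eq_bigr => w _.
rewrite word_weightE /= -[thead w :: _]/(tval [tuple of thead w :: behead w]) -tuple_eta.
have -> : \prod_(b <- w) 'X_b =
    'X_[exponents N (seq_mset (map val w))] :> {mpoly {poly rat}[N]}.
  rewrite mprodXE; congr 'X_[_]; apply/mnmP => i; rewrite mnm_sumE mnmE mset_seqE.
  rewrite -[RHS]sum1_count [RHS]big_map [RHS]big_mkcond /=; apply: eq_bigr => j _.
  by rewrite mnm1E val_eqE; case: eqP.
rewrite size_behead size_tuple /=.
have -> : \prod_(i < l) step_weight ('X%:MP : {mpoly {poly rat}[N]})
     (nth (thead w) w i) (nth (thead w) (behead w) i) =
  \prod_(i < l)
    step_weight 'X%:MP (tnth w (widen_ord (leqnSn l) i)) (tnth w (lift ord0 i)).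
  by apply: eq_bigr => i _; rewrite !(tnth_nth (thead w)) nth_behead /= /bump add1n.
rewrite prod_step_weight.
case: (proper_coloring _ _) => /=; last by rewrite mulr0 mcoeff0.
rewrite -rmorphXn mulrC mcoeffCM mcoeffX.
have wN : colors_below N (seq_mset (map val w)).
  move=> x Nx; rewrite mset_seqE; apply/count_memPn/mapP => -[i _ xi].
  by move: Nx; rewrite xi leqNgt ltn_ord.
(* Both multisets have their colors below [N], where [mset_of_exponents] inverts [exponents]. *)
rewrite (can_in_eq (f := exponents N) (g := @mset_of_exponents N)
  (D := pred2 (seq_mset (map val w)) m)) ?inE ?eqxx ?orbT //.
  by case: eqP; rewrite ?mulr1 ?mulr0.
by move=> p /pred2P[]->; exact: exponentsK.
Qed.
End Chromatic.

(** * The expansion of the chromatic series *)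

Lemma chromatic_dipath l m :
  chromatic (dipath l.+1) m =
  \sum_(d : l.-tuple bool)
     'X^(count id d) * elem_part (sort geq (sizes_from 0 d)) m.
Proof.
(* One more than the largest color in [m]. *)
pose N := (\max_(x <- m) x).+1.
have mN : colors_below N m.
  move=> x; apply: contraTeq; rewrite mset_neq0 -ltnNge ltnS => xm.
  exact: leq_bigmax_seq.
rewrite (@represents_chromatic l N m mN) sum_word_weight block_rec_qint raddf_sum /=.
apply: eq_bigr => d _; rewrite -rmorphXn mcoeffCM; congr (_ * _).
rewrite (@represents_elem_part N _ m mN); congr (_@_ _).
by apply: perm_big; rewrite perm_sym perm_sort.
Qed.

(** A partition of [n] has at most [n] parts, each at most [n], so it occurs among the bounded
    sequences over ['I_n.+1]. *)
Definition partitions n : seq (seq nat) :=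
  [seq la <- undup [seq map val (s : seq 'I_n.+1) | s : n.-bseq 'I_n.+1]
    | is_partition n la].

Lemma mem_partitions n la : (la \in partitions n) = is_partition n la.
Proof.
rewrite mem_filter mem_undup.
case: (boolP (is_partition n la)) => //= /and3P[_ la_pos /eqP la_sum].
have le_sumn k : k \in la -> (k <= sumn la)%N.
  elim: la {la_pos la_sum} => //= h la IHla; rewrite inE => /predU1P[->|/IHla]; lia.
have size_la : (size (map (@inord n) la) <= n)%N.
  rewrite size_map -la_sum {la_sum le_sumn}.
  elim: la la_pos => //= h la IHla /andP[h1 /IHla]; lia.
apply/imageP; exists (Bseq size_la) => //=.
rewrite -map_comp map_id_in // => k /le_sumn kn /=; rewrite inordK //; lia.
Qed.

Lemma e_expansionP n c F :
  e_expansion n c F <->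
  forall m, F m = \sum_(la <- partitions n) c la * elem_part la m.
Proof.
have sumE m :
    \sum_(la \in [set la : seq nat | is_partition n la]%classic) c la * elem_part la m =
    \sum_(la <- partitions n) c la * elem_part la m.
  rewrite [RHS]fsbig_seq ?filter_uniq ?undup_uniq //; apply: eq_fsbigl.
  by apply/seteqP; split=> la /=; rewrite mem_partitions.
by split=> cF m; rewrite cF sumE.
Qed.

Lemma chromatic_dipath_e_expansion l :
  e_expansion l.+1
    (fun la => \sum_(a | AO l.+1 la a) 'X^(asc_orientation (dipath l.+1) a))
    (chromatic (dipath l.+1)).
Proof.
apply/e_expansionP => m; rewrite chromatic_dipath.
transitivity (\sum_(la <- partitions l.+1)
    \sum_(d : l.-tuple bool | la == sort geq (sizes_from 0 d))
    'X^(count id d) * elem_part la m).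
  (* Each bit sequence [d] contributes to a single partition, its sorted block sizes. *)
  rewrite (exchange_big_dep xpredT) //=; apply: eq_bigr => d _.
  rewrite (big_rem (sort geq (sizes_from 0 d))) /= ?mem_partitions ?is_partition_sizes //.
  rewrite eqxx big1_seq ?addr0 // => la /andP[/eqP->].
  by rewrite rem_filter ?filter_uniq ?undup_uniq // mem_filter /= eqxx.
apply: eq_big_seq => la; rewrite mem_partitions => la_part.
rewrite mulr_suml [RHS]big_mkcond /=.
rewrite [RHS](bigID (orientation (dipath l.+1))) /= [X in _ + X]big1 ?addr0; last first.
  by move=> a /negbTE oa; rewrite /AO oa.
rewrite sum_orientation [LHS]big_mkcond; apply: eq_bigr => d _.
by rewrite AO_arcs_of_bits // asc_arcs_of_bits.
Qed.

(** * Linear independence of the elementary symmetric functions *)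

Fixpoint lex_lt (s1 s2 : seq nat) : bool :=
  match s1, s2 with
  | _, [::] => false
  | [::], _ => true
  | k1 :: s1', k2 :: s2' => (k1 < k2)%N || (k1 == k2) && lex_lt s1' s2'
  end.

Lemma lex_lt_irr s : lex_lt s s = false.
Proof. by elim: s => //= k s ->; rewrite ltnn andbF. Qed.

Lemma lex_lt_trans : transitive lex_lt.
Proof.
elim=> [|k2 s2 IHs] [|k1 s1] [|k3 s3] //=.
move=> /orP[lt12|/andP[/eqP-> lt12]] /orP[lt23|/andP[/eqP<- lt23]].
- by rewrite (ltn_trans lt12).
- by rewrite lt12.
- by rewrite lt23.
- by rewrite eqxx (IHs _ _ lt12 lt23) orbT.
Qed.

(** The multiplicity of a color [x] is the number of parts larger than [x]; the exponents form the
    conjugate partition. *)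
Definition staircase (la : seq nat) : {mset nat} :=
  foldr (fun k m => seq_mset (iota 0 k) `+` m) mset0 la.

Lemma staircase_ge la x : sorted geq la -> (head 0 la <= x)%N -> staircase la x = 0%N.
Proof.
elim: la => [|h la IHla] /=; first by rewrite mset0E.
move=> la_sorted hx; rewrite msetE2 mset_seqE IHla ?(path_sorted la_sorted) //.
  by rewrite addn0; apply/count_memPn; rewrite mem_iota add0n -leqNgt.
by case: la la_sorted {IHla} => //= k la /andP[kh _]; exact: leq_trans kh hx.
Qed.

(** A squarefree monomial [p] dividing the staircase uses only the colors below [h], so its degree
    [k] is at most [h]; for [k = h] it uses all of them, and cancelling it leaves [q]. *)
Lemma elem_staircase k h la p q : sorted geq (h :: la) ->
    p `+` q = staircase (h :: la) -> elem k p != 0 ->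
  (k <= h)%N /\ (k = h -> p = seq_mset (iota 0 h) /\ q = staircase la).
Proof.
move=> la_sorted pq; rewrite /elem;
case: (boolP (uniq p && _)) => [|_]; last by rewrite eqxx.
move=> /andP[p_uniq /eqP size_p] _.
have p_iota : {subset p <= iota 0 h}.
  move=> x; rewrite in_mset mem_iota add0n /=; apply: contraTT; rewrite -leqNgt => hx.
  have := congr1 (fun m : {mset nat} => m x) pq.
  rewrite msetE2 (staircase_ge la_sorted) //.
  by move/eqP; rewrite addn_eq0 -leqNgt leqn0 => /andP[].
split; first by have := uniq_leq_size p_uniq p_iota; rewrite size_p size_iota.
move=> kh.
have pE : p = seq_mset (iota 0 h).
  rewrite -[LHS]seq_mset_id; apply/eq_seq_msetP/uniq_perm => //; first exact: iota_uniq.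
  by have [] := uniq_min_size p_uniq p_iota; rewrite // size_p kh size_iota.
split=> //; apply/msetP => x; have := congr1 (fun m : {mset nat} => m x) pq.
by rewrite pE /= !msetE2 => /addnI.
Qed.

Lemma elem_part_staircase_lex la mu : sorted geq la -> all (leq 1) mu ->
  elem_part mu (staircase la) != 0 -> (mu == la) || lex_lt mu la.
Proof.
elim: mu la => [|k mu IHmu] la la_sorted; first by case: la {la_sorted}.
move=> /= /andP[k1 mu_pos]; apply: contraNT => not_lex; apply/eqP.
apply: fsbig1 => -[p q] /= pq; apply/eqP; apply: contraNT not_lex.
rewrite mulf_eq0 negb_or => /andP[kp muq].
case: la la_sorted pq => [|h la] la_sorted pq.
  (* The staircase of the empty partition is the monomial 1, whose factor [p] has degree 0, against
     [k >= 1]. *)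
  have p0 : p = mset0.
    apply/msetP => x; have /(congr1 (fun m : {mset nat} => m x)) := pq.
    by rewrite msetE2 !mset0E => /eqP; rewrite addn_eq0 => /andP[/eqP].
  by move: kp k1; rewrite p0 /elem enum_mset0; case: (k) => // k'; rewrite /= mulr0n eqxx.
have [kh khE] := elem_staircase la_sorted pq kp.
move: kh; rewrite leq_eqVlt => /predU1P[kh|->]; last by rewrite orbT.
rewrite kh eqxx ltnn eqseq_cons eqxx /=.
apply: IHmu => //; first exact: path_sorted la_sorted.
by have [_ <-] := khE kh.
Qed.

Lemma elem_part_staircase la : sorted geq la -> elem_part la (staircase la) = 1.
Proof.
elim: la => [|h la IHla] la_sorted; first by rewrite /elem_part /= /series1 eqxx.
rewrite /elem_part /= /series_mul.
(* By [elem_staircase], this is the only splitting with a nonzero first factor. *)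
rewrite -(@fsbig_widen _ _ _ _ [set (seq_mset (iota 0 h), staircase la)]%classic) /=.
- rewrite fsbig_set1 /= -/(elem_part la _) IHla ?(path_sorted la_sorted) // mulr1.
  rewrite /elem (perm_uniq (perm_eq_seq_mset _)) iota_uniq.
  by rewrite (perm_size (perm_eq_seq_mset _)) size_iota eqxx.
- by move=> _ ->.
move=> [p q] /= [pq pqN]; apply/eqP; apply: contra_notT pqN.
rewrite mulf_eq0 negb_or => /andP[hp _].
by have [_ /(_ erefl)[-> ->]] := elem_staircase la_sorted pq hp.
Qed.

(** Induction on the number [r la] of partitions of [n] lexicographically below [la]. At the
    coefficient of [staircase la], the relation reads [f la] plus terms with [mu] below [la], which
    vanish by induction. *)
Lemma elem_part_free n (f : seq nat -> {poly rat}) :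
    (forall m, \sum_(la <- partitions n) f la * elem_part la m = 0) ->
  forall la, is_partition n la -> f la = 0.
Proof.
move=> f0 la; pose r la := count (lex_lt^~ la) (partitions n).
have [b] := ubnP (r la); elim: b la => // b IHb la r_la la_part.
have /and3P[la_sorted _ _] := la_part.
have := f0 (staircase la).
rewrite (big_rem la) ?mem_partitions //= elem_part_staircase // mulr1.
rewrite big1_seq ?addr0 // => mu /=.
rewrite rem_filter ?filter_uniq ?undup_uniq // mem_filter /= mem_partitions.
move=> /andP[mu_la mu_part].
have /and3P[_ mu_pos _] := mu_part.
have [->|] := eqVneq (elem_part mu (staircase la)) 0; first by rewrite mulr0.
move=> /(elem_part_staircase_lex la_sorted mu_pos); rewrite (negbTE mu_la) /= => lt_mu.
rewrite IHb ?mul0r //; move: r_la; rewrite ltnS; apply: leq_trans.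
(* To get [r mu < r la], [mu] itself is counted along with the partitions below it; all of these lie
   below [la]. *)
rewrite -add1n -[1%N](_ : count_mem mu (partitions n) = 1%N); last first.
  by rewrite count_uniq_mem ?filter_uniq ?undup_uniq // mem_partitions mu_part.
rewrite -count_predUI [X in (_ + X)%N](_ : _ = 0%N) ?addn0; last first.
  apply/eqP; rewrite -leqn0 leqNgt -has_count; apply/hasPn => nu _ /=.
  by case: eqP => // ->; rewrite lex_lt_irr.
apply: sub_count => nu /= /predU1P[->//|nu_mu]; exact: lex_lt_trans nu_mu lt_mu.
Qed.

Theorem proposition15 (n : nat) (n_ge1 : (1 <= n)%N) :
  (exists c : seq nat -> {poly rat},
     e_expansion n c (chromatic (dipath n)))
  /\
  (forall c : seq nat -> {poly rat},
     e_expansion n c (chromatic (dipath n)) ->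
     forall la : seq nat, is_partition n la ->
       c la = \sum_(a : {set 'I_n * 'I_n} | AO n la a)
                'X^(asc_orientation (dipath n) a)).
Proof.
case: n n_ge1 => // l _; have X_exp := chromatic_dipath_e_expansion l.
split; first by eexists; exact: X_exp.
move=> c /e_expansionP c_exp la la_part; apply/eqP; rewrite -subr_eq0; apply/eqP.
pose c0 la := \sum_(a | AO l.+1 la a) 'X^(asc_orientation (dipath l.+1) a) : {poly rat}.
apply: (elem_part_free (f := fun la => c la - c0 la) _ la_part) => m.
under eq_bigr do rewrite mulrBl.
by rewrite sumrB -c_exp -(proj1 (e_expansionP _ _ _) X_exp) subrr.
Qed.
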